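(* Let $d$ be a positive integer and $n\geq0$ an integer. The $d$-signature map $\Psi$ is constant on $\mathcal{J}$-classes of $\mathcal{P}_d(\mathbf{n})$, and the induced map $\Psi:(\mathcal{P}_d(\mathbf{n})/\mathcal{J},\rightsquigarrow)\to(I(n\mathbf{e}(1)),\prec)$ is an isomorphism of posets.
   Context: Partition monoid: let $\underline n=\{1,\dots,n\}$, $\underline n'=\{1',\dots,n'\}$, $\mathbf n=\underline n\cup\underline n'$, and $\mathcal{P}(\mathbf n)$ the set of set partitions of $\mathbf n$ into nonempty blocks. For $\sigma,\pi\in\mathcal{P}(\mathbf n)$, the product $\sigma\circ\pi$ is defined as follows: take a third copy $\underline n''=\{1'',\dots,n''\}$; let $\sigma'$ be the partition of $\underline n'\cup\underline n''$ obtained from $\sigma$ by renaming $i\mapsto i'$, $j'\mapsto j''$; let $\tau$ be the finest equivalence relation on $\underline n\cup\underline n'\cup\underline n''$ containing both $\pi$ and $\sigma'$; restrict $\tau$ to $\underline n\cup\underline n''$ and rename $j''\mapsto j'$. This makes $\mathcal{P}(\mathbf n)$ a monoid with identity $\{\{1,1'\},\dots,\{n,n'\}\}$. The $d$-tonal partition monoid $\mathcal{P}_d(\mathbf n)$ is the submonoid of all $\sigma$ such that every block $B$ of $\sigma$ satisfies $d\mid |B\cap\underline n|-|B\cap\underline n'|$. Write $M=\mathcal{P}_d(\mathbf n)$. Elements $\sigma,\pi$ are $\mathcal J$-equivalent if $M\sigma M=M\pi M$; on $\mathcal J$-classes, $\overline\sigma\rightsquigarrow\overline\pi$ iff $M\sigma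 M\subseteq M\pi M$. $d$-signature: $\Psi(\sigma)=(v_1,\dots,v_d)$ where $v_i$ is the number of blocks $B$ of $\sigma$ with $B\cap\underline n\neq\varnothing$, $B\cap\underline n'\neq\varnothing$ and $d\mid |B\cap\underline n|-i$. Poset: $\Lambda_d=\mathbb{Z}_{\geq0}^d$ with basis $\mathbf{e}(1),\dots,\mathbf{e}(d)$; $X_d=\{\mathbf{e}(k)-\mathbf{e}(i)-\mathbf{e}(j): i,j,k\in\{1,\dots,d\},\ d\mid k-i-j\}$; for $\mathbf{v},\mathbf{w}\in\Lambda_d$, $\mathbf{v}\lessdot\mathbf{w}$ iff $\mathbf{v}-\mathbf{w}\in X_d$; $\prec$ is the transitive closure of $\lessdot$ on $\Lambda_d$; $I(\mathbf v)=\{\mathbf v\}\cup\{\mathbf w\in\Lambda_d:\mathbf w\prec\mathbf v\}$. *)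

(* Defs.v *)
From HB Require Import structures.
From mathcomp Require Import all_boot all_order all_algebra.
From mathcomp Require Import boolp.
From Stdlib Require Import Relation_Operators.

Set Implicit Arguments.
Unset Strict Implicit.
Unset Printing Implicit Defensive.

Import Order.TTheory GRing.Theory Num.Theory.

(* The set n u n': [inl i] is the vertex i and [inr i] the vertex i'. *)
Notation bold n := ('I_n + 'I_n)%type.

Record part (n : nat) : Type := Part {
  blocks :> {set {set bold n}};
  _ : partition blocks [set: bold n]
}.
HB.instance Definition _ n := [isSub for @blocks n].
HB.instance Definition _ n := [Finite of part n by <:].

Definition upper n (B : {set bold n}) : {set 'I_n} := [set i | inl i \in B].
Definition lower n (B : {set bold n}) : {set 'I_n} := [set i | inr i \in B].

Definition same_block n (s : part n) : rel (bold n) :=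
  fun x y => y \in pblock s x.

(* Transport of the relation [r] along the vertex map [f]. *)
Definition relimg (A B : finType) (f : A -> B) (r : rel A) : rel B :=
  fun x y => [exists a, [exists b, [&& r a b, f a == x & f b == y]]].

(* Three layers: [inl (inl i)] is i, [inl (inr i)] is i', [inr i] is i''. *)
Notation bold3 n := ('I_n + 'I_n + 'I_n)%type.

Definition emb12 n : bold n -> bold3 n := inl.
Definition emb23 n (x : bold n) : bold3 n :=
  match x with inl i => inl (inr i) | inr i => inr i end.
Definition emb13 n (x : bold n) : bold3 n :=
  match x with inl i => inl (inl i) | inr i => inr i end.

Definition glue n (s p : part n) : rel (bold3 n) :=
  relU (relimg (@emb12 n) (same_block p)) (relimg (@emb23 n) (same_block s)).

(* [glue s p] is symmetric, so [connect] gives the least equivalence. *)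
Definition comp_rel n (s p : part n) : rel (bold n) :=
  fun x y => connect (glue s p) (emb13 x) (emb13 y).

Lemma same_block_equiv n (s : part n) :
  [/\ reflexive (same_block s), symmetric (same_block s)
    & transitive (same_block s)].
Proof.
have /pblock_equivalence e := valP s.
have e' x y z := e x y z (in_setT _) (in_setT _) (in_setT _).
rewrite /same_block; split=> [x|x y|y x z xy yz].
- by have [] := e' x x x.
- have [xx xy] := e' x y x; have [yy yx] := e' y x y.
  by apply/idP/idP => h; [rewrite -(xy h) xx | rewrite -(yx h) yy].
- by have [_ ->] := e' x y z.
Qed.

Lemma relimg_sym (A B : finType) (f : A -> B) (r : rel A) :
  symmetric r -> symmetric (relimg f r).
Proof.
move=> sr x y; apply/existsP/existsP => -[a /existsP[b /and3P[rab fa fb]]];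
by exists b; apply/existsP; exists a; rewrite sr rab fa fb.
Qed.

Lemma relimgP (A B : finType) (f : A -> B) (r : rel A) x y :
  reflect (exists a b, [/\ r a b, f a = x & f b = y]) (relimg f r x y).
Proof.
apply: (iffP existsP) => [[a /existsP[b /and3P[rab /eqP fa /eqP fb]]]|].
  by exists a, b.
by move=> [a [b [rab <- <-]]]; exists a; apply/existsP; exists b;
   rewrite rab !eqxx.
Qed.

Lemma relimg_f (A B : finType) (f : A -> B) (r : rel A) a b :
  r a b -> relimg f r (f a) (f b).
Proof. by move=> rab; apply/relimgP; exists a, b. Qed.

Lemma glue_sym n (s p : part n) : symmetric (glue s p).
Proof.
have [_ ss _] := same_block_equiv s; have [_ sp _] := same_block_equiv p.
by move=> x y; rewrite /glue /= !(relimg_sym _ ss x, relimg_sym _ sp x).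
Qed.

Lemma comp_rel_equiv n (s p : part n) :
  {in [set: bold n] & &, equivalence_rel (comp_rel s p)}.
Proof.
move=> x y z _ _ _; rewrite /comp_rel connect0; split=> // xy.
exact: (same_connect (sym_connect_sym (@glue_sym _ s p)) xy).
Qed.

(* [part_mul s p] is s o p: [p] sits on the first two layers, [s] on the last
   two. *)
Definition part_mul n (s p : part n) : part n :=
  Part (equivalence_partitionP (@comp_rel_equiv n s p)).

Definition id_blocks n : {set {set bold n}} :=
  [set [set inl i; inr i] | i : 'I_n].

Definition underlying n (x : bold n) : 'I_n :=
  match x with inl i => i | inr i => i end.

Lemma mem_id_block n (i : 'I_n) (x : bold n) :
  (x \in [set inl i; inr i]) = (underlying x == i).
Proof. by rewrite !inE; case: x => j; rewrite ?orbF //= eq_sym. Qed.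

Lemma id_partition n : partition (id_blocks n) [set: bold n].
Proof.
apply/and3P; split.
- apply/eqP/setP => x; rewrite inE; apply/bigcupP.
  by exists [set inl (underlying x); inr (underlying x)];
     [exact: imset_f | rewrite mem_id_block].
- apply/trivIsetP => _ _ /imsetP[i _ ->] /imsetP[j _ ->]; apply: contraR.
  case/pred0Pn=> z /andP[]; rewrite /= !mem_id_block => /eqP <- /eqP <-.
  by rewrite eqxx.
- apply/imsetP => -[i _ /setP/(_ (inl i))].
  by rewrite mem_id_block !inE eqxx.
Qed.

Definition id_part n : part n := Part (id_partition n).

Lemma part_ext n (s p : part n) : same_block s =2 same_block p -> s = p.
Proof.
move=> e; apply: val_inj => /=.
rewrite -(equivalence_partition_pblock (valP s)).
rewrite -(equivalence_partition_pblock (valP p)).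
apply: eq_imset => x; apply/setP => y; rewrite !inE /=.
exact: e.
Qed.

Lemma same_block_comp n (s p : part n) :
  same_block (part_mul s p) =2 comp_rel s p.
Proof.
move=> x y; rewrite /same_block /=.
by rewrite pblock_equivalence_partition ?inE //; exact: comp_rel_equiv.
Qed.

Lemma same_block_id n (x y : bold n) :
  same_block (id_part n) x y = (underlying x == underlying y).
Proof.
have [_ ti _] := and3P (id_partition n).
rewrite /same_block /=.
rewrite (@def_pblock _ _ [set inl (underlying x); inr (underlying x)]) //.
- by rewrite mem_id_block eq_sym.
- exact: imset_f.
- by rewrite mem_id_block.
Qed.

Lemma connect_ind (T : finType) (e : rel T) (P : T -> Prop) x y :
  P x -> (forall u v, P u -> e u v -> P v) -> connect e x y -> P y.
Proof.
move=> Px step /connectP[q pq ->{y}].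
elim: q x Px pq => //= z q IH x Px /andP[xz]; exact/IH/(step x).
Qed.

Lemma connect_hom (A B : finType) (f : A -> B) (r : rel A) (e : rel B) a b :
  (forall u v, r u v -> connect e (f u) (f v)) ->
  connect r a b -> connect e (f a) (f b).
Proof.
move=> h; apply: (connect_ind (P := fun b => connect e (f a) (f b))) => //.
by move=> u v au /h; apply: connect_trans.
Qed.

Lemma glueP n (s p : part n) x y :
  reflect ((exists a b, [/\ same_block p a b, emb12 a = x & emb12 b = y]) \/
           (exists a b, [/\ same_block s a b, emb23 a = x & emb23 b = y]))
          (glue s p x y).
Proof. by apply: (iffP orP) => -[] /relimgP; [left|right|left|right]. Qed.

Lemma comp1p n : left_id (id_part n) (@part_mul n).
Proof.
move=> p; have [rp _ tp] := same_block_equiv p.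
apply: part_ext => x y; rewrite same_block_comp /comp_rel.
pose F (z : bold3 n) : bold n := match z with inl a => a | inr i => inr i end.
have FK z : F (emb13 z) = z by case: z.
apply/idP/idP.
  rewrite -{2}(FK x) -{2}(FK y).
  apply: (connect_ind (P := fun z => same_block p (F (emb13 x)) (F z))).
    exact: rp.
  move=> u v xu /glueP[] [a [b [ab au bv]]]; subst u v; first exact: tp xu ab.
  suff -> : F (emb23 b) = F (emb23 a) by [].
  move: ab; rewrite same_block_id.
  by case: (a) (b) => i [] j /= /eqP ->.
move=> xy; have toF z : connect (glue (id_part n) p) (emb13 z) (emb12 z).
  case: z => i; first exact: connect0.
  apply/connect1/glueP; right; exists (inr i), (inl i).
  by rewrite same_block_id.
apply: connect_trans (toF x) _.
rewrite (sym_connect_sym (@glue_sym _ _ _)).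
apply: connect_trans (toF y) _.
rewrite (sym_connect_sym (@glue_sym _ _ _)).
by apply/connect1/glueP; left; exists x, y.
Qed.

Lemma compp1 n : right_id (id_part n) (@part_mul n).
Proof.
move=> p; have [rp _ tp] := same_block_equiv p.
apply: part_ext => x y; rewrite same_block_comp /comp_rel.
pose F (z : bold3 n) : bold n :=
  match z with inl (inl i) => inl i | inl (inr i) => inl i | inr i => inr i end.
have FK z : F (emb13 z) = z by case: z.
apply/idP/idP.
  rewrite -{2}(FK x) -{2}(FK y).
  apply: (connect_ind (P := fun z => same_block p (F (emb13 x)) (F z))).
    exact: rp.
  move=> u v xu /glueP[] [a [b [ab au bv]]]; subst u v.
    suff -> : F (emb12 b) = F (emb12 a) by [].
    move: ab; rewrite same_block_id.
    by case: (a) (b) => i [] j /= /eqP ->.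
  have F2 c : F (emb23 c) = c by case: c.
  by move: xu; rewrite !F2 => /tp; apply.
move=> xy; have toF z : connect (glue p (id_part n)) (emb13 z) (emb23 z).
  case: z => i; last exact: connect0.
  apply/connect1/glueP; left; exists (inl i), (inr i).
  by rewrite same_block_id.
apply: connect_trans (toF x) _.
rewrite (sym_connect_sym (@glue_sym _ _ _)).
apply: connect_trans (toF y) _.
rewrite (sym_connect_sym (@glue_sym _ _ _)).
by apply/connect1/glueP; right; exists x, y.
Qed.

(* Gluing first along [g] on an overlap [N], then along [q], agrees with gluing
   everything at once in the amalgam [W]. *)
Lemma collapse (N V1 V2 W : finType) (g : rel V1) (q : rel V2)
    (i : N -> V1) (j : N -> V2) (h : V1 -> W) (k : V2 -> W) (r : rel N) :
  injective h -> injective k -> (forall a, h (i a) = k (j a)) ->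
  (forall v u, h v = k u -> exists2 a, v = i a & u = j a) ->
  (forall a b, r a b = connect g (i a) (i b)) ->
  forall x y, connect (relU (relimg j r) q) x y =
              connect (relU (relimg h g) (relimg k q)) (k x) (k y).
Proof.
move=> ih ik hk ov rE x y; set F := relU (relimg j r) q.
set E := relU (relimg h g) _.
have rF a b : r a b -> F (j a) (j b) by move=> rab; rewrite /F /= relimg_f.
have qF u v : q u v -> F u v by rewrite /F /= orbC => ->.
apply/idP/idP.
  apply: connect_hom => u v /orP[/relimgP[a [b [rab <- <-]]]|quv].
    rewrite -!hk; move: rab; rewrite rE; apply: connect_hom => c d cd.
    by apply: connect1; rewrite /E /= relimg_f.
  by apply: connect1; rewrite /E /= orbC relimg_f.
pose P w := (exists2 u, w = k u & connect F x u) \/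
  (exists a v, [/\ w = h v, connect F x (j a) & connect g (i a) v]).
suff: connect E (k x) (k y) -> P (k y).
  move=> /[apply] -[[u /ik <- //]|[a [v [/esym/ov[b -> ->] xa ab]]]].
  by apply: connect_trans xa (connect1 _); apply: rF; rewrite rE.
apply: connect_ind; first by left; exists x.
move=> w w' Pw /orP[] /relimgP[c [d [cd wc wd]]]; rewrite -{w}wc -{w'}wd in Pw *.
- right; case: Pw => [[u /ov[a ca ua] xa]|[a [v [/ih <- xa av]]]].
    by exists a, d; split=> //; [rewrite -ua | rewrite -ca; apply: connect1].
  by exists a, d; split=> //; apply: connect_trans av (connect1 cd).
- left; exists d => //; case: Pw => [[u /ik <- xu]|].
    by apply: connect_trans xu (connect1 _); apply: qF.
  move=> [a [v [/esym/ov[b vb cb] xa av]]].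
  apply: connect_trans xa _; apply: (@connect_trans _ _ c).
    by apply: connect1; rewrite cb; apply: rF; rewrite rE -vb.
  by apply: connect1; apply: qF.
Qed.

Lemma relimgU (A B : finType) (f : A -> B) (r1 r2 : rel A) :
  relimg f (relU r1 r2) =2 relU (relimg f r1) (relimg f r2).
Proof.
move=> x y; apply/relimgP/orP.
  by move=> [a [b [/orP[] rab fa fb]]]; [left|right]; apply/relimgP; exists a, b.
by case=> /relimgP[a [b [rab fa fb]]]; exists a, b; rewrite /= rab ?orbT.
Qed.

Lemma relimg_comp (A B C : finType) (f : A -> B) (g : B -> C) (r : rel A) :
  relimg g (relimg f r) =2 relimg (g \o f) r.
Proof.
move=> x y; apply/relimgP/relimgP.
  by move=> [_ [_ [/relimgP[a [b [rab <- <-]]] <- <-]]]; exists a, b.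
move=> [a [b [rab <- <-]]]; exists (f a), (f b); split=> //.
exact: relimg_f.
Qed.

Lemma eq_relimg (A B : finType) (f f' : A -> B) (r : rel A) :
  f =1 f' -> relimg f r =2 relimg f' r.
Proof.
by move=> e x y; apply/relimgP/relimgP => -[a [b [rab <- <-]]];
   exists a, b; rewrite !e.
Qed.

Lemma compA n : associative (@part_mul n).
Proof.
move=> r s p; apply: part_ext => x y; rewrite !same_block_comp /comp_rel.
pose W := ('I_n + 'I_n + 'I_n + 'I_n)%type.
pose h123 : bold3 n -> W := inl.
pose h134 (z : bold3 n) : W := match z with
  inl (inl i) => inl (inl (inl i)) | inl (inr i) => inl (inr i)
  | inr i => inr i end.
pose h234 (z : bold3 n) : W := match z with
  inl (inl i) => inl (inl (inr i)) | inl (inr i) => inl (inr i)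
  | inr i => inr i end.
pose h124 (z : bold3 n) : W := match z with
  inl (inl i) => inl (inl (inl i)) | inl (inr i) => inl (inl (inr i))
  | inr i => inr i end.
have i134 : injective h134 by move=> [[a|a]|a] [[b|b]|b] //= [->].
have i234 : injective h234 by move=> [[a|a]|a] [[b|b]|b] //= [->].
have i124 : injective h124 by move=> [[a|a]|a] [[b|b]|b] //= [->].
have i123 : injective h123 by move=> a b [].
rewrite {1}/glue (@collapse _ _ _ W (glue s p) _ (@emb13 n) _ h123 h134) //;
  last first.
- exact: same_block_comp.
- by move=> [[a|a]|a] [[b|b]|b] //= [->]; [exists (inl b) | exists (inr b)].
- by move=> [].
have e1 : connect (glue (part_mul r s) p) =2 connect
    (relU (relimg (@emb23 n) (same_block (part_mul r s)))
          (relimg (@emb12 n) (same_block p))).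
  by apply: eq_connect => u v; rewrite /glue /= orbC.
rewrite e1 (@collapse _ _ _ W (glue r s) _ (@emb13 n) _ h234 h124) //;
  last first.
- exact: same_block_comp.
- by move=> [[a|a]|a] [[b|b]|b] //= [->]; [exists (inl b) | exists (inr b)].
- by move=> [].
have -> : h134 (emb13 x) = h124 (emb13 x) by case: x.
have -> : h134 (emb13 y) = h124 (emb13 y) by case: y.
apply: eq_connect => u v /=; rewrite /glue !relimgU /= !relimg_comp.
rewrite (@eq_relimg _ _ (h124 \o @emb12 n) (h123 \o @emb12 n)); last by case.
rewrite (@eq_relimg _ _ (h234 \o @emb23 n) (h134 \o @emb23 n)); last by case.
rewrite (@eq_relimg _ _ (h234 \o @emb12 n) (h123 \o @emb23 n)); last by case.
by rewrite [RHS]orbC orbA.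
Qed.

HB.instance Definition _ n :=
  isMonoid.Build (part n) (@compA n) (@comp1p n) (@compp1 n).

Local Open Scope ring_scope.

Definition tonal (d n : nat) : {pred part n} :=
  [pred s | [forall B in blocks s,
    (d%:Z %| #|upper B|%:Z - #|lower B|%:Z)%Z]].

Arguments tonal : clear implicits.

Section TonalClosed.
Variables d n : nat.

Definition tone (A : {set bold n}) : int := #|upper A|%:Z - #|lower A|%:Z.

Lemma toneE A :
  tone A = (\sum_(x in A) (if x is inl _ then 1 else -1))%R.
Proof.
rewrite big_sumType /= /tone; congr (_ + _)%R.
  by rewrite sumr_const natz; congr Posz; apply: eq_card => i; rewrite inE.
rewrite sumr_const mulNrn natz; congr (- Posz _).
by apply: eq_card => i; rewrite inE.
Qed.

Lemma saturated_tone (s : part n) (A : {set bold n}) : s \in tonal d n ->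
  (forall x y, same_block s x y -> x \in A -> y \in A) -> (d%:Z %| tone A)%Z.
Proof.
move=> /forall_inP ts sat; rewrite toneE.
suff <- : \sum_(B in blocks s | B \subset A) tone B =
    \sum_(x in A) (if x is inl _ then 1 else -1).
  by apply: rpred_sum => B /andP[/ts].
under [LHS]eq_bigr do rewrite toneE.
have ps := valP s; rewrite -/(blocks s) in ps *.
rewrite [RHS](eq_bigl (fun x => (x \in [set: bold n]) && (x \in A))); last first.
  by move=> x; rewrite inE.
rewrite (set_partition_big_cond _ ps) /= big_mkcondr /=.
apply: eq_bigr => B Bs; case: ifPn => [/subsetP BA|nBA].
  by apply: eq_bigl => x; apply/idP/andP => [xB|[]//]; rewrite xB BA.
rewrite big_pred0 // => x; apply/negP => /andP[xB xA].
case/negP: nBA; apply/subsetP => y yB; apply: sat xA.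
have [_ ti _] := and3P ps.
by rewrite /same_block (def_pblock ti Bs xB).
Qed.

Lemma tonal_monoid_closed : monoid_closed (tonal d n).
Proof.
split=> [|s p ts tp].
  apply/forall_inP => _ /imsetP[i _ ->].
  have -> : upper [set inl i; inr i] = [set i].
    by apply/setP => j; rewrite in_set mem_id_block in_set1.
  have -> : lower [set inl i; inr i] = [set i].
    by apply/setP => j; rewrite in_set mem_id_block in_set1.
  by rewrite subrr dvdz0.
apply/forall_inP => _ /imsetP[x _ ->].
set C := [set y in _ | _].
pose D := [set z | connect (glue s p) (emb13 x) z].
have Dp : (d%:Z %| tone (@emb12 n @^-1: D))%Z.
  apply: (saturated_tone tp) => a b ab; rewrite !inE => xa.
  by apply: connect_trans xa (connect1 _); apply/glueP; left; exists a, b.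
have Ds : (d%:Z %| tone (@emb23 n @^-1: D))%Z.
  apply: (saturated_tone ts) => a b ab; rewrite !inE => xa.
  by apply: connect_trans xa (connect1 _); apply/glueP; right; exists a, b.
have := rpredD Dp Ds.
rewrite /tone (_ : upper (@emb12 n @^-1: D) = upper C); last first.
  by apply/setP => i; rewrite !inE.
rewrite (_ : lower (@emb12 n @^-1: D) = upper (@emb23 n @^-1: D)); last first.
  by apply/setP => i; rewrite !inE.
rewrite (_ : lower (@emb23 n @^-1: D) = lower C); last first.
  by apply/setP => i; rewrite !inE.
by rewrite addrA subrK.
Qed.

End TonalClosed.

Definition tonal_part (d n : nat) : Type := {s : part n | s \in tonal d n}.
HB.instance Definition _ d n := SubFinite.on (tonal_part d n).
HB.instance Definition _ d n :=
  SubChoice_isSubMonoid.Build (part n) (tonal d n) (tonal_part d n)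
    (@tonal_monoid_closed d n).


(* The two-sided principal ideal M s M. *)
Definition ideal2 d n (s : tonal_part d n) : {set tonal_part d n} :=
  [set (x * s * y)%g | x : tonal_part d n, y : tonal_part d n].

Definition Jeq d n : rel (tonal_part d n) :=
  fun s p => ideal2 s == ideal2 p.

Fact Jeq_equiv d n : equiv_class_of (@Jeq d n).
Proof.
split=> [s|s p|p s q]; rewrite /Jeq; first exact: eqxx.
  by rewrite eq_sym.
by move=> /eqP -> /eqP ->.
Qed.
Canonical Jeq_equivRel d n := EquivRelPack (@Jeq_equiv d n).

Definition Jclass (d n : nat) : Type := {eq_quot (Jeq_equivRel d n)}%qT.
HB.instance Definition _ d n := Choice.on (Jclass d n).
HB.instance Definition _ d n := EqQuotient.on (Jclass d n).

Definition Jle d n : rel (Jclass d n) := lift_fun2 (Jclass d n)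
  (fun s p => ideal2 s \subset ideal2 p).

Lemma ideal2_repr d n (s : tonal_part d n) :
  ideal2 (repr (\pi_(Jclass d n) s)%qT) = ideal2 s.
Proof. by apply/eqP; rewrite -/(Jeq _ _) -[Jeq _ _]eqmodE reprK. Qed.

Lemma JleE d n (s p : tonal_part d n) :
  Jle (\pi_(Jclass d n) s)%qT (\pi_(Jclass d n) p)%qT =
    (ideal2 s \subset ideal2 p).
Proof. by unlock Jle; rewrite !ideal2_repr. Qed.

Fact Jle_refl d n : reflexive (@Jle d n).
Proof. by elim/quotW => s; rewrite JleE. Qed.
Fact Jle_anti d n : antisymmetric (@Jle d n).
Proof.
elim/quotW => s; elim/quotW => p; rewrite !JleE -eqEsubset => sp.
by apply/eqP; rewrite eqmodE.
Qed.
Fact Jle_trans d n : transitive (@Jle d n).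
Proof.
elim/quotW => s; elim/quotW => p; elim/quotW => q.
by rewrite !JleE; apply: subset_trans.
Qed.

(* [<=] on [Jclass d n] is the order ~>. *)
Fact J_display : Order.disp_t. Proof. exact: Order.Disp tt tt. Qed.
HB.instance Definition _ d n := Order.Le_isPOrder.Build J_display (Jclass d n)
  (@Jle_refl d n) (@Jle_anti d n) (@Jle_trans d n).

(* Index [t : 'I_d] stands for the label t.+1 in {1, ..., d}. *)
Definition Lambda (d : nat) : Type := {ffun 'I_d -> nat}.
HB.instance Definition _ d := Choice.on (Lambda d).
HB.instance Definition _ d := GRing.Nmodule.on (Lambda d).

(* e(i), where i is the label in {1, ..., d}. *)
Definition basis (d i : nat) : Lambda d := [ffun t : 'I_d => nat_of_bool (t.+1 == i)].

Definition signature d n (s : part n) : Lambda d :=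
  [ffun t : 'I_d => #|[set B in blocks s | [&& upper B != set0, lower B != set0
     & (d%:Z %| #|upper B|%:Z - t.+1%:Z)%Z]]|].

Definition to_int d (v : Lambda d) : {ffun 'I_d -> int} :=
  [ffun t => (v t)%:Z].

Definition in_X d (x : {ffun 'I_d -> int}) : Prop :=
  exists i j k : nat,
    [/\ (0 < i <= d)%N, (0 < j <= d)%N, (0 < k <= d)%N,
        (d%:Z %| k%:Z - i%:Z - j%:Z)%Z
      & x = to_int (basis d k) - to_int (basis d i) - to_int (basis d j)].

Definition covered d (v w : Lambda d) : Prop := in_X (to_int v - to_int w).

Definition prec d (v w : Lambda d) : bool := `[< clos_trans _ (@covered d) v w >].

Lemma sum_basis d i : (0 < i <= d)%N -> \sum_t to_int (basis d i) t = 1.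
Proof.
case: i => // i ltid; rewrite (bigD1 (Ordinal ltid)) //= !ffunE eqxx big1 ?addr0 //.
move=> t /eqP ti; rewrite !ffunE eqSS; case: eqP => // e.
by case: ti; apply: val_inj.
Qed.

Lemma prec_sum d (v w : Lambda d) :
  prec v w -> \sum_t to_int v t < \sum_t to_int w t.
Proof.
move=> /asboolP; elim=> {v w} [v w|u v w _ + _]; last exact: lt_trans.
move=> [i [j [k [hi hj hk _ /ffunP e]]]]; rewrite -subr_lt0 -sumrB.
rewrite (eq_bigr (fun t => to_int (basis d k) t - to_int (basis d i) t
                           - to_int (basis d j) t)).
  by rewrite !sumrB !sum_basis.
by move=> t _; have := e t; rewrite !ffunE.
Qed.

Fact prec_irr d : irreflexive (@prec d).
Proof. by move=> v; apply/negP => /prec_sum; rewrite ltxx. Qed.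

Fact prec_trans d : transitive (@prec d).
Proof.
move=> v u w /asboolP uv /asboolP vw; apply/asboolP; exact: t_trans uv vw.
Qed.

(* [<] on [Lambda d] is [prec], and [<=] its reflexive closure. *)
Fact Lambda_display : Order.disp_t. Proof. exact: Order.Disp tt tt. Qed.
HB.instance Definition _ d := Order.Lt_isPOrder.Build Lambda_display (Lambda d)
  (@prec_irr d) (@prec_trans d).

(* I(v). *)
Definition down d (v : Lambda d) : {pred Lambda d} :=
  [pred w | (w == v) || prec w v].
Arguments down : clear implicits.

Definition down_set d (v : Lambda d) : Type := {w : Lambda d | w \in down d v}.
HB.instance Definition _ d (v : Lambda d) := SubChoice.on (down_set v).
HB.instance Definition _ d (v : Lambda d) :=
  [SubChoice_isSubPOrder of down_set v by <: with Lambda_display].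

(* Main.v *)
(* Describe a partition by a labelling of its vertices whose fibres are the
   blocks.  A map f from the blocks of p to the blocks of s that hits every
   transversal block of s from a transversal block of p, and preserves modulo d
   the number of upper vertices carrying each label, is equivalent both to s
   lying in M p M and to Psi(s) being at most Psi(p).  Given f, one writes
   s = x p y where y glues the upper half of s to that of p along equal labels,
   and x does the same below.  A product yields such maps by sending a block of
   a factor to its component in the glued diagram.  On signatures f amounts to
   replacing groups of residues by their sum and deleting groups whose sum is
   0, which are chains of coverings.  Conversely, a covering is realised by
   merging two transversal blocks (residues i, j both different from d) or by
   cutting a block of residue d, and equal signatures give a residue-preserving
   matching of the transversal blocks. *)
Require Import Defs.
From mathcomp Require Import all_boot all_order all_algebra.
From mathcomp Require Import boolp zify.
From Stdlib Require Import Relation_Operators.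

Set Implicit Arguments.
Unset Strict Implicit.
Unset Printing Implicit Defensive.

Import Order.TTheory GRing.Theory Num.Theory.

(** * Residues modulo [d] and the order on [Lambda d] *)

(** Indexing by arbitrary naturals lets block sizes be used directly; every multiple of [d] gives
    [basis d d]. *)
Definition ebasis (d m : nat) : Lambda d :=
  [ffun t : 'I_d => nat_of_bool (m == t.+1 %[mod d])].

Lemma ebasis_mod d a b : a = b %[mod d] -> ebasis d a = ebasis d b.
Proof. by move=> ab; apply/ffunP => t; rewrite !ffunE ab. Qed.

Lemma eq_label_mod d i j :
  0 < i <= d -> 0 < j <= d -> (i == j %[mod d]) = (i == j).
Proof.
case: i => // i; case: j => // j /= id jd.
by rewrite -!(addn1 i) -!(addn1 j) eqn_modDr !modn_small // eqn_add2r.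
Qed.

Lemma ebasis_basis d i : 0 < i <= d -> ebasis d i = basis d i.
Proof.
move=> id; apply/ffunP => t; rewrite !ffunE eq_label_mod ?ltn_ord //.
by rewrite eq_sym.
Qed.

(* The representative of [m] modulo [d] in {1, ..., d}. *)
Definition label d m := ((m + d.-1) %% d).+1.

Lemma label_bound d m : 0 < d -> 0 < label d m <= d.
Proof. by move=> d0; rewrite /= ltn_mod. Qed.

Lemma label_mod d m : 0 < d -> label d m = m %[mod d].
Proof.
by case: d => // d _; rewrite /label -addn1 modnDml -addnA addn1 modnDr.
Qed.

Lemma ebasis_label d m : 0 < d -> ebasis d m = basis d (label d m).
Proof.
move=> d0; rewrite -ebasis_basis ?label_bound //.
by apply: ebasis_mod; rewrite label_mod.
Qed.

Lemma dvdz_mod d a b : (d%:Z %| (a%:Z - b%:Z)%R)%Z = (a == b %[mod d]).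
Proof. by rewrite -eqz_mod_dvd !modz_nat. Qed.

Lemma Lambda_leE d (v w : Lambda d) : (v <= w)%O = (v == w) || prec v w.
Proof. exact: Order.POrderTheory.le_eqVlt. Qed.

Lemma covered_le d (v w : Lambda d) : covered v w -> (v <= w)%O.
Proof.
by move=> c; rewrite Lambda_leE; apply/orP; right; apply/asboolP/t_step.
Qed.

Lemma covered_addl d (u v w : Lambda d) :
  covered v w -> covered (u + v)%R (u + w)%R.
Proof.
rewrite /covered; suff -> : (to_int (u + v) - to_int (u + w) = to_int v - to_int w)%R by [].
apply/ffunP => t; rewrite !ffunE !PoszD opprD addrACA subrr add0r //.
Qed.

Lemma Lambda_leD2l d (u v w : Lambda d) : (v <= w)%O -> (u + v <= u + w)%O%R.
Proof.
rewrite !Lambda_leE => /orP[/eqP -> | /asboolP vw]; first by rewrite eqxx.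
apply/orP; right; apply/asboolP.
elim: vw => [x y /(covered_addl u)|x y z _ xy _ yz]; first exact: t_step.
exact: t_trans xy yz.
Qed.

Lemma Lambda_leD d (u v w x : Lambda d) :
  (u <= v)%O -> (w <= x)%O -> (u + w <= v + x)%O%R.
Proof.
move=> uv wx; apply: (@le_trans _ _ (u + x)%R); first exact: Lambda_leD2l.
by rewrite ![(_ + x)%R]addrC; exact: Lambda_leD2l.
Qed.

(** The labels of [a], [b] and [a + b] satisfy the congruence in [in_X], so this is a single
    covering. *)
Lemma ebasis_merge d a b :
  0 < d -> (ebasis d (a + b) <= ebasis d a + ebasis d b)%O%R.
Proof.
move=> d0; apply: covered_le.
exists (label d a), (label d b), (label d (a + b)); split; rewrite ?label_bound //.
  rewrite -addrA -opprD -PoszD dvdz_mod label_mod //.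
  by rewrite -[in X in _ == X]modnDm !label_mod // modnDm.
apply/ffunP => t; rewrite !ebasis_label // !ffunE PoszD opprD addrA //.
Qed.

(** Taking all three labels equal to [d] is admissible and gives minus [basis d d], so deleting a
    residue 0 is a covering. *)
Lemma ebasis_drop d m : 0 < d -> d %| m -> ((0 : Lambda d) <= ebasis d m)%O%R.
Proof.
move=> d0 dm; apply: covered_le.
exists d, d, d; rewrite d0 leqnn; split => //.
  by rewrite subrr sub0r dvdzE abszN /=.
have -> : ebasis d m = basis d d.
  rewrite -ebasis_basis ?d0 ?leqnn //; apply: ebasis_mod.
  by rewrite modnn; apply/eqP.
by apply/ffunP => t; rewrite !ffunE /= subrr.
Qed.

(** The selection must be nonempty: an empty one has total 0, and [ebasis d 0] is [basis d d], not
    the zero vector. *)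
Lemma ebasis_sum d (I : Type) (r : seq I) (P : pred I) (m : I -> nat) :
  0 < d -> has P r ->
  (ebasis d (\sum_(i <- r | P i) m i) <= \sum_(i <- r | P i) ebasis d (m i))%O%R.
Proof.
move=> d0; elim: r => //= i r IH; rewrite !big_cons.
case: (P i) => //= _; case: (boolP (has P r)) => [/IH le_r|noP].
  exact: le_trans (ebasis_merge _ _ d0) (Lambda_leD2l _ le_r).
by rewrite !big_hasC // addn0 addr0.
Qed.

(** Merge everything into one residue, then drop it; an empty selection is trivial. *)
Lemma ebasis_sum0 d (I : Type) (r : seq I) (P : pred I) (m : I -> nat) :
  0 < d -> d %| \sum_(i <- r | P i) m i ->
  ((0 : Lambda d) <= \sum_(i <- r | P i) ebasis d (m i))%O%R.
Proof.
move=> d0 dm; case: (boolP (has P r)) => [hP|noP]; last by rewrite big_hasC.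
exact: le_trans (ebasis_drop d0 dm) (ebasis_sum _ d0 hP).
Qed.

(** * Labellings, tonality and signatures *)

Section Labelling.
Variable n : nat.

Definition nup (K : eqType) (L : bold n -> K) (C : K) : nat :=
  #|[set i | L (inl i) == C]|.
Definition nlow (K : eqType) (L : bold n -> K) (C : K) : nat :=
  #|[set i | L (inr i) == C]|.
Definition crosses (K : eqType) (L : bold n -> K) (C : K) : bool :=
  (0 < nup L C) && (0 < nlow L C).

Definition labels (s : part n) (K : eqType) (L : bold n -> K) : Prop :=
  forall x y, same_block s x y = (L x == L y).

Lemma nup_gt0P (K : eqType) (L : bold n -> K) C :
  reflect (exists i, L (inl i) = C) (0 < nup L C).
Proof.
rewrite [0 < _]card_gt0; apply: (iffP (set0Pn _)) => -[i].
  by rewrite inE => /eqP; exists i.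
by move=> <-; exists i; rewrite inE.
Qed.

Lemma nlow_gt0P (K : eqType) (L : bold n -> K) C :
  reflect (exists i, L (inr i) = C) (0 < nlow L C).
Proof.
rewrite [0 < _]card_gt0; apply: (iffP (set0Pn _)) => -[i].
  by rewrite inE => /eqP; exists i.
by move=> <-; exists i; rewrite inE.
Qed.

Definition ker_part (K : eqType) (L : bold n -> K) : part n :=
  Part (preim_partitionP L [set: bold n]).

Lemma labels_ker_part (K : eqType) (L : bold n -> K) : labels (ker_part L) L.
Proof.
move=> x y; rewrite /same_block /= pblock_equivalence_partition ?inE //.
by move=> a b c _ _ _; split=> // /eqP ->.
Qed.

Lemma labels_pblock (s : part n) : labels s (pblock s).
Proof.
move=> x y; have /and3P[/eqP covs tis _] := valP s.
by rewrite /same_block eq_pblock // covs inE.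
Qed.

Section Fibres.
Variables (s : part n) (K : eqType) (L : bold n -> K).
Hypothesis sL : labels s L.

Lemma blocks_labels B :
  reflect (exists x, B = [set y | L y == L x]) (B \in blocks s).
Proof.
have /and3P[/eqP covs tis nz] := valP s; rewrite -/(blocks s) in covs tis nz.
have pbE x : pblock s x = [set y | L y == L x].
  by apply/setP => y; have := sL x y; rewrite /same_block inE eq_sym.
apply: (iffP idP) => [Bs|[x ->]].
  have [x xB] : exists x, x \in B.
    by apply/set0Pn; apply: contraNneq nz => <-.
  by exists x; rewrite -pbE (def_pblock tis Bs xB).
by rewrite -pbE pblock_mem // covs inE.
Qed.

Lemma card_upper_fibre C : #|upper [set y | L y == C]| = nup L C.
Proof. by congr #|pred_of_set _|; apply/setP => i; rewrite !inE. Qed.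

Lemma card_lower_fibre C : #|lower [set y | L y == C]| = nlow L C.
Proof. by congr #|pred_of_set _|; apply/setP => i; rewrite !inE. Qed.

(** Every fibre is a union of blocks, and every block is a fibre. *)
Lemma tonal_labels d :
  s \in tonal d n <-> (forall C, nup L C = nlow L C %[mod d]).
Proof.
split=> [ts C|h].
  have := @saturated_tone d n s [set y | L y == C] ts.
  rewrite /tone card_upper_fibre card_lower_fibre dvdz_mod => h; apply/eqP/h.
  by move=> x y; rewrite sL !inE => /eqP ->.
apply/forall_inP => B /blocks_labels[x ->].
by rewrite card_upper_fibre card_lower_fibre dvdz_mod h.
Qed.

End Fibres.

Definition residue_class d (K : finType) (L : bold n -> K) (m : nat) : {set K} :=
  [set C | crosses L C && (nup L C == m %[mod d])].

(** Passing to the fibre is injective on crossing labels, because their fibres are nonempty. *)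
Lemma signature_card d (s : part n) (K : finType) (L : bold n -> K) (t : 'I_d) :
  labels s L -> signature d s t = #|residue_class d L t.+1|.
Proof.
move=> sL; rewrite ffunE; pose g C := [set y : bold n | L y == C].
have -> : [set B in blocks s | [&& upper B != set0, lower B != set0
      & (d%:Z %| (#|upper B|%:Z - t.+1%:Z)%R)%Z]] = g @: residue_class d L t.+1.
  apply/setP => B; apply/setIdP/imsetP.
    case=> /(blocks_labels sL)[x ->]; rewrite -!card_gt0.
    rewrite card_upper_fibre card_lower_fibre dvdz_mod => /and3P[u l e].
    by exists (L x) => //; rewrite inE /crosses u l.
  case=> C; rewrite inE => /andP[/andP[u l] e] ->.
  rewrite -!card_gt0 card_upper_fibre card_lower_fibre dvdz_mod u l e; split=> //.
  by apply/(blocks_labels sL); case/nup_gt0P: u => i <-; exists (inl i).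
rewrite card_in_imset // => C D.
rewrite !inE => /andP[/andP[/nup_gt0P[i iC] _] _] _ /setP/(_ (inl i)).
by rewrite !inE iC eqxx => /esym/eqP.
Qed.

(** One vector per crossing block: inequalities of signatures can then be proved by grouping
    blocks. *)
Lemma signature_labels d (s : part n) (K : finType) (L : bold n -> K) :
  labels s L ->
  signature d s = (\sum_(C | crosses L C) ebasis d (nup L C))%R.
Proof.
move=> sL; apply/ffunP => t; rewrite (signature_card t sL) sum_ffunE.
under [RHS]eq_bigr do rewrite ffunE.
rewrite -[RHS]/(\sum_(C | crosses L C) (nup L C == t.+1 %[mod d] : nat))%N.
by rewrite -big_mkcondr sum1dep_card.
Qed.

End Labelling.

(** * Reductions: their effect on signatures and their realisation by products *)

(* [f] is unconstrained on blocks of [Lp] that do not cross, and its values need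
   not be labels of [L]: only the counts modulo [d] matter. *)
Definition reduction d n (K H : eqType) (L : bold n -> K) (Lp : bold n -> H)
    (f : H -> K) : Prop :=
  (forall C, crosses L C -> exists2 B, crosses Lp B & f B = C) /\
  (forall C, nup L C = nup (f \o Lp) C %[mod d]).

Lemma nup_comp n (K : eqType) (H : finType) (L : bold n -> H) (f : H -> K) C :
  nup (f \o L) C = \sum_(B | f B == C) nup L B.
Proof.
rewrite /nup -sum1dep_card (partition_big (fun i => L (inl i)) (fun B => f B == C)) //=.
apply: eq_bigr => B /eqP fB; rewrite -sum1dep_card; apply: eq_bigl => i.
by rewrite andbC; case: (L (inl i) =P B) => [->|] //=; rewrite fB eqxx.
Qed.

Lemma labels_comp_tonal d n (p : part n) (K H : eqType) (L : bold n -> H)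
    (f : H -> K) : labels p L -> p \in tonal d n ->
  forall C, nup (f \o L) C = nlow (f \o L) C %[mod d].
Proof.
move=> pL tp C; have := @saturated_tone d n p [set x | f (L x) == C] tp.
rewrite /tone !card_upper_fibre !card_lower_fibre dvdz_mod => h; apply/eqP/h.
by move=> x y; rewrite pL !inE => /eqP ->.
Qed.

Lemma noncrossing_nup d n (K : eqType) (L : bold n -> K) C :
  nup L C = nlow L C %[mod d] -> ~~ crosses L C -> nup L C = 0 %[mod d].
Proof.
rewrite /crosses; case: (posnP (nup L C)) => [->//|_].
by case: (posnP (nlow L C)) => [->|].
Qed.

(** By tonality noncrossing labels have counts divisible by [d], so they vanish from the sum. *)
Lemma crosses_nup_sum d n (K : eqType) (H : finType) (L : bold n -> H)
    (f : H -> K) C :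
  (forall B, nup L B = nlow L B %[mod d]) ->
  \sum_(B | crosses L B && (f B == C)) nup L B = nup (f \o L) C %[mod d].
Proof.
move=> tL; rewrite nup_comp [in RHS](bigID (crosses L)) /= -modnDmr.
rewrite [X in _ + X](_ : _ = 0) ?addn0.
  by congr (_ %% d); apply: eq_bigl => B; rewrite andbC.
apply/eqP; apply: dvdn_sum => B /andP[_ nB].
by apply/eqP; rewrite (noncrossing_nup (tL B) nB) mod0n.
Qed.

(** Group the crossing blocks of [p] by their image [C]. The residues in a group add up to that of
    [C]. If [C] crosses, the group is nonempty and merges into it; otherwise the sum is 0 modulo [d]
    and the group can be deleted. *)
Lemma reduction_signature d n (s p : part n) (K H : finType)
    (L : bold n -> K) (Lp : bold n -> H) (f : H -> K) :
  0 < d -> s \in tonal d n -> p \in tonal d n -> labels s L -> labels p Lp ->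
  reduction d L Lp f -> (signature d s <= signature d p)%O.
Proof.
move=> d0 ts tp sL pLp [hb hc].
have {}ts := (tonal_labels sL d).1 ts; have {}tp := (tonal_labels pLp d).1 tp.
rewrite (signature_labels d sL) (signature_labels d pLp) big_mkcond.
rewrite (partition_big f predT) //=.
apply: (big_ind2 (fun u v : Lambda d => (u <= v)%O)) => //.
  by move=> *; exact: Lambda_leD.
move=> C _; have sumE :
    \sum_(B | crosses Lp B && (f B == C)) nup Lp B = nup L C %[mod d].
  by rewrite (crosses_nup_sum _ _ tp) -hc.
case: ifPn => [tC|ntC].
  rewrite -(ebasis_mod sumE); apply: ebasis_sum => //.
  have [B tB fB] := hb _ tC; apply/hasP; exists B; first exact: mem_index_enum.
  by rewrite tB fB eqxx.
apply: ebasis_sum0 => //; apply/eqP.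
by rewrite sumE (noncrossing_nup (ts C) ntC) mod0n.
Qed.

Definition lift_labels n (K : Type) (up low : 'I_n -> K) (x : bold n) : K :=
  match x with inl i => up i | inr j => low j end.

(* [y] joins the upper half of [s] to that of [p] along equal labels, and [x]
   joins the lower halves. *)
Lemma reduction_sandwich d n (s p : part n) (K H : eqType)
    (L : bold n -> K) (Lp : bold n -> H) (f : H -> K) :
  s \in tonal d n -> p \in tonal d n -> labels s L -> labels p Lp ->
  reduction d L Lp f ->
  exists x y, [/\ x \in tonal d n, y \in tonal d n & s = part_mul (part_mul x p) y].
Proof.
move=> ts tp sL pLp [hb hc].
pose F := f \o Lp.
have Fp a b : same_block p a b -> F a = F b by rewrite pLp /F /= => /eqP ->.
pose Ly := lift_labels (fun i => L (inl i)) (fun j => F (inl j)).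
pose Lx := lift_labels (fun i => F (inr i)) (fun j => L (inr j)).
pose x := ker_part Lx; pose y := ker_part Ly.
have xE : labels x Lx by exact: labels_ker_part.
have yE : labels y Ly by exact: labels_ker_part.
have ty : y \in tonal d n.
  by apply/(tonal_labels yE) => C; exact: hc.
have tx : x \in tonal d n.
  apply/(tonal_labels xE) => C.
  (* The congruence passes from lower to upper counts of [F] by tonality of [p], to upper counts of
     [L] by the reduction, and to lower counts of [L] by tonality of [s]. *)
  transitivity (nlow F C %% d); first by [].
  rewrite -(labels_comp_tonal f pLp tp) -hc.
  by rewrite ((tonal_labels sL d).1 ts).
exists x, y; split => //; set q := part_mul x p.
(* Only one implication holds for [Lq]: blocks of [p] with the same image under [f] need not be
   joined in [q]. *)
pose Lq := lift_labels (fun i => F (inl i)) (fun j => L (inr j)).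
have qL a b : same_block q a b -> Lq a = Lq b.
  rewrite same_block_comp /comp_rel.
  pose L3 (z : bold3 n) := match z with inl a => F a | inr j => L (inr j) end.
  have E z : Lq z = L3 (emb13 z) by case: z.
  rewrite !E; apply: (connect_ind (P := fun z => L3 (emb13 a) = L3 z)) => //.
  move=> u v -> /glueP[] [c [e [ce <- <-]]]; first exact: Fp.
  by move: ce; rewrite xE; case: c => i; case: e => j /eqP.
have qlow a b : L (inr a) = L (inr b) -> same_block q (inr a) (inr b).
  move=> ab; rewrite same_block_comp; apply/connect1/glueP; right.
  by exists (inr a), (inr b); split; rewrite // xE; apply/eqP.
(* A crossing label needs an actual connection through [p], which the crossing block from [hb]
   provides. *)
have qmid C : crosses L C ->
    exists2 i, F (inl i) = C & forall b, L (inr b) = C -> same_block q (inl i) (inr b).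
  move=> /hb[B /andP[/nup_gt0P[i iB] /nlow_gt0P[j jB]] fB].
  exists i => [|b bC]; first by rewrite /F /= iB.
  rewrite same_block_comp; apply: (@connect_trans _ _ (emb12 (inr j))).
    apply/connect1/glueP; left; exists (inl i), (inr j).
    by split=> //; rewrite pLp iB jB.
  apply/connect1/glueP; right; exists (inl j), (inr b).
  by split=> //; rewrite xE /= /F /= jB fB bC.
apply: part_ext => u v; rewrite sL same_block_comp /comp_rel.
have cs := sym_connect_sym (@glue_sym _ q y).
apply/eqP/idP; last first.
  (* This labelling of the three layers is constant along edges, so gluing never joins distinct
     labels of [s]. *)
  pose L3 (z : bold3 n) := match z with
    inl (inl i) => L (inl i) | inl (inr i) => F (inl i) | inr j => L (inr j) end.
  have E z : L z = L3 (emb13 z) by case: z.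
  rewrite !E; apply: (connect_ind (P := fun z => L3 (emb13 u) = L3 z)) => //.
  move=> _ _ -> /glueP[] [c [e [ce <- <-]]].
    by move: ce; rewrite yE; case: c => i; case: e => j /eqP.
  by have := qL _ _ ce; case: (c) => i; case: (e) => j.
have cross i j : L (inl i) = L (inr j) ->
    connect (glue q y) (emb13 (inl i)) (emb13 (inr j)).
  move=> ij; have tC : crosses L (L (inl i)).
    by apply/andP; split; [apply/nup_gt0P; exists i|apply/nlow_gt0P; exists j].
  have [k Fk qk] := qmid _ tC.
  apply: (@connect_trans _ _ (emb12 (inr k))).
    apply/connect1/glueP; left; exists (inl i), (inr k).
    by split=> //; rewrite yE /= Fk.
  by apply/connect1/glueP; right; exists (inl k), (inr j); split=> //; exact: qk.
case: u => i; case: v => j ij.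
- apply/connect1/glueP; left; exists (inl i), (inl j).
  by split=> //; rewrite yE; apply/eqP.
- exact: cross.
- by rewrite cs; apply: cross.
- by apply/connect1/glueP; right; exists (inr i), (inr j); split=> //; exact: qlow.
Qed.

(** * Signatures of products *)

(** [k0] is the value at labels carried by no vertex. *)
Lemma labels_factor n (p : part n) (H : eqType) (K : Type) (k0 : K)
    (L : bold n -> H) (F : bold n -> K) :
  labels p L -> (forall a b, same_block p a b -> F a = F b) ->
  exists f : H -> K, F =1 f \o L.
Proof.
move=> pL pF; exists (fun h => if [pick a | L a == h] is Some a then F a else k0).
move=> a /=; case: pickP => [b ba|/(_ a)]; last by rewrite eqxx.
by apply: pF; rewrite pL eq_sym.
Qed.

Section ProductSignature.
Variables (d n : nat) (s p : part n).
Hypotheses (d0 : 0 < d) (ts : s \in tonal d n) (tp : p \in tonal d n).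

(** Components of the glued diagram serve as labels for the product and, through the embeddings, as
    targets of maps from the blocks of [p] and of [s]. *)
Let comp (z : bold3 n) : {set bold3 n} := [set w | connect (glue s p) z w].

Let compE z w : (comp z == comp w) = connect (glue s p) z w.
Proof.
have cs := sym_connect_sym (@glue_sym _ s p).
apply/eqP/idP => [/setP/(_ w)|zw]; first by rewrite !inE connect0.
by apply/setP => u; rewrite !inE (same_connect cs zw).
Qed.

Let labels_comp : labels (part_mul s p) (comp \o @emb13 n).
Proof. by move=> x y; rewrite same_block_comp /= compE. Qed.

(** A path from top to bottom leaves the top layer for the middle through a crossing block of [p],
    and enters the bottom layer through one of [s]. *)
Let comp_crosses C : crosses (comp \o @emb13 n) C ->
  (exists i j, same_block p (inl i) (inr j) /\ comp (inl (inl i)) = C) /\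
  (exists i j, same_block s (inl i) (inr j) /\ comp (inl (inr i)) = C).
Proof.
case/andP => /nup_gt0P[i0 i0C] /nlow_gt0P[j0 j0C].
have cs := sym_connect_sym (@glue_sym _ s p).
have ij : connect (glue s p) (inl (inl i0)) (inr j0).
  by rewrite -compE; apply/eqP; exact: etrans i0C (esym j0C).
have step u v : comp u = C -> glue s p u v -> comp v = C.
  by move=> <- uv; apply/eqP; rewrite eq_sym compE connect1.
split; set goal := ex _.
  (* Along the path, either the required block has been met or the vertex is still on the top layer;
     the endpoint excludes the latter. *)
  pose P z := comp z = C /\ (goal \/ exists i, z = inl (inl i)).
  suff [_ [//|[i //]]] : P (inr j0).
  apply: connect_ind ij => [|u v [uC [g|[i ui]]] uv]; first by split=> //; right; exists i0.
    by split; [exact: step uC uv|left].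
  split; [exact: step uC uv|subst u].
  case/glueP: uv => [[a [b [ab [au] <-]]]|[[a|a] [b []]]] //; subst a.
  by case: b ab => j ab; [right; exists j|left; exists i, j].
(* The same argument on the reversed path, starting from the bottom layer. *)
pose P z := comp z = C /\ (goal \/ exists j, z = inr j).
rewrite cs in ij; suff [_ [//|[i //]]] : P (inl (inl i0)).
apply: connect_ind ij => [|u v [uC [g|[j uj]]] uv]; first by split=> //; right; exists j0.
  by split; [exact: step uC uv|left].
have vC := step _ _ uC uv; split=> //; subst u.
case/glueP: uv => [[a [b []]]|[[a|a] [b [ab]]]] //= [aj] bv; subst a v.
case: b ab vC => i ab vC; last by right; exists i.
have [_ ss _] := same_block_equiv s.
by left; exists i, j; rewrite ss.
Qed.

Lemma signature_mul_le :
  (signature d (part_mul s p) <= signature d p)%O /\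
  (signature d (part_mul s p) <= signature d s)%O.
Proof.
have tm : part_mul s p \in tonal d n by have [_ m] := tonal_monoid_closed d n; exact: m.
have gp a b : same_block p a b -> comp (emb12 a) = comp (emb12 b).
  by move=> ab; apply/eqP; rewrite compE; apply/connect1/glueP; left; exists a, b.
have gs a b : same_block s a b -> comp (emb23 a) = comp (emb23 b).
  by move=> ab; apply/eqP; rewrite compE; apply/connect1/glueP; right; exists a, b.
have [f fE] := labels_factor set0 (@labels_pblock _ p) gp.
have [g gE] := labels_factor set0 (@labels_pblock _ s) gs.
have trans (q : part n) i j : same_block q (inl i) (inr j) ->
    crosses (pblock q) (pblock q (inl i)).
  rewrite labels_pblock => /eqP ij; apply/andP.
  by split; [apply/nup_gt0P; exists i|apply/nlow_gt0P; exists j].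
have nupE (F G : bold n -> {set bold3 n}) C :
    (forall i, F (inl i) = G (inl i)) -> nup F C = nup G C.
  by move=> FG; apply: eq_card => i; rewrite !inE FG.
split.
  apply: (reduction_signature d0 tm tp labels_comp (@labels_pblock _ p) (f := f)).
  split=> C; last by congr (_ %% d); apply: nupE => i; rewrite /= -[RHS]fE.
  move=> /comp_crosses[[i [j [ij iC]]] _]; exists (pblock p (inl i)); first exact: trans ij.
  by rewrite -[LHS]fE.
apply: (reduction_signature d0 tm ts labels_comp (@labels_pblock _ s) (f := g)).
split=> C.
  move=> /comp_crosses[_ [i [j [ij iC]]]]; exists (pblock s (inl i)); first exact: trans ij.
  by rewrite -[LHS]gE.
(* The upper vertices of [s] are the lower ones of [p] in the middle layer, so tonality of [p]
   carries the count from the top layer to the middle. *)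
transitivity (nup (f \o pblock p) C %% d).
  by congr (_ %% d); apply: nupE => i; rewrite /= -[RHS]fE.
rewrite (labels_comp_tonal f (@labels_pblock _ p) tp); congr (_ %% d).
by apply: eq_card => i; rewrite !inE; have /= <- := fE (inr i); have /= <- := gE (inl i).
Qed.

End ProductSignature.

(** * Matching blocks under equal signatures *)

Lemma card_residue_class d n (s : part n) (K : finType) (L : bold n -> K) m
    (t : 'I_d) : labels s L -> m = t.+1 %[mod d] ->
  #|residue_class d L m| = signature d s t.
Proof.
move=> sL mt; rewrite (signature_card t sL); apply: eq_card => C.
by rewrite !inE mt.
Qed.

(* Equal signatures allow matching crossing blocks residue class by residue
   class; noncrossing blocks do not affect the counts modulo [d], so their
   image is irrelevant. *)
Lemma eq_signature_reduction d n (s p : part n) :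
  0 < d -> s \in tonal d n -> p \in tonal d n -> signature d s = signature d p ->
  exists f, reduction d (pblock s) (pblock p) f.
Proof.
move=> d0 ts tp sp.
have sL := @labels_pblock _ s; have pL := @labels_pblock _ p.
have {}ts := (tonal_labels sL d).1 ts; have {}tp := (tonal_labels pL d).1 tp.
pose cl (q : part n) m := enum (residue_class d (pblock q) m).
have cl_mod (q : part n) m m' : m = m' %[mod d] -> cl q m = cl q m'.
  by move=> mm; apply: eq_enum => C; rewrite !inE mm.
have cl_size m : size (cl s m) = size (cl p m).
  rewrite -!cardE; have /andP[_ lt_label] := label_bound m d0.
  have lm : m = (Ordinal lt_label).+1 %[mod d] by rewrite /= [RHS](label_mod m d0).
  by rewrite (card_residue_class sL lm) (card_residue_class pL lm) sp.
have mem_cl (q : part n) m C :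
    (C \in cl q m) = crosses (pblock q) C && (nup (pblock q) C == m %[mod d]).
  by rewrite mem_enum inE.
have cl_uniq (q : part n) m : uniq (cl q m) by exact: enum_uniq.
pose f B := nth set0 (cl s (nup (pblock p) B)) (index B (cl p (nup (pblock p) B))).
have f_cl B : crosses (pblock p) B -> f B \in cl s (nup (pblock p) B).
  by move=> cB; apply: mem_nth; rewrite cl_size index_mem mem_cl cB eqxx.
have f_surj C : crosses (pblock s) C ->
    exists2 B, B \in cl p (nup (pblock s) C) & f B = C.
  set m := nup _ C => cC; have Cm : C \in cl s m by rewrite mem_cl cC eqxx.
  have lti : index C (cl s m) < size (cl p m) by rewrite -cl_size index_mem.
  exists (nth set0 (cl p m) (index C (cl s m))); first exact: mem_nth.
  have := mem_nth set0 lti; rewrite mem_cl => /andP[_ /eqP e].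
  by rewrite /f !(cl_mod _ _ _ e) index_uniq // nth_index.
have f_inj B B' : crosses (pblock p) B -> crosses (pblock p) B' -> f B = f B' -> B = B'.
  move=> cB cB' fB.
  have := f_cl _ cB; rewrite mem_cl fB => /andP[_ /eqP e1].
  have := f_cl _ cB'; rewrite mem_cl => /andP[_ /eqP e2].
  have e : nup (pblock p) B = nup (pblock p) B' %[mod d] by rewrite -e1 -e2.
  move: fB; rewrite /f !(cl_mod _ _ _ e) => /eqP.
  have Bm : B \in cl p (nup (pblock p) B') by rewrite mem_cl cB e eqxx.
  have Bm' : B' \in cl p (nup (pblock p) B') by rewrite mem_cl cB' eqxx.
  rewrite nth_uniq ?cl_size ?index_mem // => /eqP ii.
  by rewrite -(nth_index set0 Bm) ii nth_index.
exists f; split=> C.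
  by move=> /f_surj[B + <-]; rewrite mem_cl => /andP[cB _]; exists B.
(* A crossing [C] has exactly one crossing preimage, of the same residue; a noncrossing [C] has
   none, and its own count is 0 modulo [d]. *)
rewrite -(crosses_nup_sum f C tp); have [cC|ncC] := boolP (crosses (pblock s) C).
  have [B + fB] := f_surj _ cC; rewrite mem_cl => /andP[cB /eqP <-].
  rewrite (big_pred1 B) // => B'; apply/andP/eqP => [[cB' /eqP fB']|->].
    by apply: f_inj => //; rewrite fB'.
  by rewrite cB fB.
rewrite big_pred0 => [|B]; first exact: noncrossing_nup.
apply/andP => -[cB /eqP fB]; case/negP: ncC.
by have := f_cl _ cB; rewrite mem_cl fB => /andP[].
Qed.

(** * Realising coverings by cutting and merging blocks *)

Definition sandwiched d n (p s : part n) : Prop :=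
  exists x y, [/\ x \in tonal d n, y \in tonal d n & s = part_mul (part_mul x p) y].

(** Both halves of [B] have size divisible by [d], so separating them keeps tonality. The identity
    is additive because [Lambda d] has no subtraction. *)
Lemma sandwiched_cut d n (p : part n) B :
  p \in tonal d n -> crosses (pblock p) B -> d %| nup (pblock p) B ->
  exists s, [/\ s \in tonal d n, sandwiched d p s
    & (signature d s + ebasis d (nup (pblock p) B))%R = signature d p].
Proof.
move=> tp cB dB; set L0 := pblock p; have pL : labels p L0 := @labels_pblock _ p.
have tL := (tonal_labels pL d).1 tp.
(* [None] labels the detached upper half, while the lower half keeps [Some B]. *)
pose f h := if h == B then None else Some h.
pose L := lift_labels (fun i => f (L0 (inl i))) (fun j => Some (L0 (inr j))).
have sL : labels (ker_part L) L := labels_ker_part L.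
have upN : nup L None = nup L0 B.
  by apply: eq_card => i; rewrite !inE /= /f; case: (_ =P B).
have lowN : nlow L None = 0 by apply: eq_card0 => i; rewrite !inE.
have lowS C : nlow L (Some C) = nlow L0 C by apply: eq_card => i; rewrite !inE.
have upB : nup L (Some B) = 0.
  by apply: eq_card0 => i; rewrite !inE /= /f; case: (_ =P B) => // iB; apply/eqP => -[].
have upS C : C != B -> nup L (Some C) = nup L0 C.
  move=> CB; apply: eq_card => i; rewrite !inE /= /f.
  by case: (L0 (inl i) =P B) => [->|//]; rewrite [RHS]eq_sym (negPf CB).
have cE C : crosses L (Some C) = crosses L0 C && (C != B).
  rewrite /crosses lowS; case: eqVneq => [->|CB]; first by rewrite upB andbF.
  by rewrite upS // andbT.
have ts : ker_part L \in tonal d n.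
  apply/(tonal_labels sL) => -[C|]; last first.
    by rewrite upN lowN mod0n; apply/eqP.
  rewrite lowS -tL; case: (eqVneq C B) => [->|/upS -> //].
  by rewrite upB mod0n; apply/esym/eqP.
exists (ker_part L); split=> //.
  apply: (reduction_sandwich ts tp sL pL (f := f)); split=> // -[C|].
    by rewrite cE => /andP[cC CB]; exists C; rewrite // /f (negPf CB).
  by rewrite /crosses lowN andbF.
rewrite (signature_labels d sL) (signature_labels d pL) [RHS](bigD1 B) //= addrC.
congr (_ + _)%R; rewrite (reindex_omap Some id) /=; last first.
  by case=> // /andP[_]; rewrite lowN.
apply: eq_big => [C|C]; rewrite eqxx andbT ?cE // => /andP[_ CB].
by rewrite upS.
Qed.

Lemma sandwiched_merge d n (p : part n) B1 B2 :
  p \in tonal d n -> crosses (pblock p) B1 -> crosses (pblock p) B2 -> B1 != B2 ->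
  exists s, [/\ s \in tonal d n, sandwiched d p s
    & (signature d s + (ebasis d (nup (pblock p) B1) + ebasis d (nup (pblock p) B2))
       = signature d p + ebasis d (nup (pblock p) B1 + nup (pblock p) B2))%R].
Proof.
move=> tp c1 c2 B12; set L0 := pblock p; have pL : labels p L0 := @labels_pblock _ p.
pose f h := if h == B2 then B1 else h.
pose L := f \o L0; have sL : labels (ker_part L) L := labels_ker_part L.
have ts : ker_part L \in tonal d n.
  by apply/(tonal_labels sL) => C; exact: labels_comp_tonal tp _.
have fE C h : C != B1 -> C != B2 -> (f h == C) = (h == C).
  rewrite /f => C1 C2; case: (eqVneq h B2) => [->|//].
  by rewrite ![_ == C]eq_sym (negPf C1) (negPf C2).
have upE C : C != B1 -> C != B2 -> nup L C = nup L0 C.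
  by move=> C1 C2; apply: eq_card => i; rewrite !inE /= fE.
have lowE C : C != B1 -> C != B2 -> nlow L C = nlow L0 C.
  by move=> C1 C2; apply: eq_card => i; rewrite !inE /= fE.
have ncB2 : crosses L B2 = false.
  apply/negP => /andP[/nup_gt0P[i]]; rewrite /L /= /f.
  by case: eqP => [_ e|//]; rewrite e eqxx in B12.
have fB1 : f B1 = B1 by rewrite /f (negPf B12).
have cB1 : crosses L B1.
  case/andP: c1 => /nup_gt0P[i iB] /nlow_gt0P[j jB]; apply/andP; split.
    by apply/nup_gt0P; exists i; rewrite /L /= [L0 _]iB.
  by apply/nlow_gt0P; exists j; rewrite /L /= [L0 _]jB.
have upB1 : nup L B1 = nup L0 B1 + nup L0 B2.
  rewrite nup_comp (bigD1 B1) /= ?fB1 // (bigD1 B2) /=; last first.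
    by rewrite /f eqxx eq_sym eqxx.
  rewrite big1 ?addn0 // => C; rewrite /f.
  by case: (eqVneq C B2) => [_|_]; rewrite ?andbF ?andbT //; case: eqVneq.
exists (ker_part L); split=> //.
  apply: (reduction_sandwich ts tp sL pL (f := f)); split=> // C.
  case: (eqVneq C B1) => [-> _|C1]; first by exists B1.
  case: (eqVneq C B2) => [->|C2]; first by rewrite ncB2.
  by rewrite /crosses upE // lowE // => cC; exists C; rewrite // /f (negPf C2).
rewrite (signature_labels d sL) (signature_labels d pL) (bigD1 B1) //= upB1.
rewrite [X in (_ = X + _)%R](bigD1 B1) //= [X in (_ = _ + X + _)%R](bigD1 B2) /=; last first.
  by rewrite c2 eq_sym.
rewrite [RHS]addrC -addrA; congr (_ + _)%R.
rewrite [LHS]addrC -addrA; congr (_ + (_ + _))%R.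
apply: eq_big => [C|C /andP[cC C1]]; last first.
  by rewrite upE //; apply: contraTneq cC => ->; rewrite ncB2.
case: (eqVneq C B1) => [_|C1]; rewrite ?andbF ?andbT //=.
case: (eqVneq C B2) => [->|C2]; rewrite ?ncB2 ?andbF //.
by rewrite /crosses upE // lowE // andbT.
Qed.

Lemma residue_class_neq0 d n (p : part n) i :
  0 < i <= d -> (forall t : 'I_d, t.+1 = i -> 0 < signature d p t) ->
  exists B, B \in residue_class d (pblock p) i.
Proof.
case: i => // i id /(_ (Ordinal id) erefl).
by rewrite (signature_card _ (@labels_pblock _ p)) => /card_gt0P.
Qed.

Lemma sandwiched_covered d n (p : part n) (v : Lambda d) :
  p \in tonal d n -> covered v (signature d p) ->
  exists s, [/\ s \in tonal d n, sandwiched d p s & signature d s = v].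
Proof.
move=> tp [i [j [k [hi hj hk]]]]; rewrite -addrA -opprD -PoszD dvdz_mod => kij e.
(* Moving the negative terms across turns the covering into an identity of naturals. *)
have {}e (t : 'I_d) : v t + ((t.+1 == i) + (t.+1 == j)) = signature d p t + (t.+1 == k).
  by move/ffunP/(_ t): e; rewrite !ffunE; lia.
have cut : (forall t : 'I_d, v t + (t.+1 == d) = signature d p t) ->
    exists s, [/\ s \in tonal d n, sandwiched d p s & signature d s = v].
  move=> e'; have d0 : 0 < d by lia.
  have [|t td|B] := @residue_class_neq0 d n p d; first by rewrite d0 leqnn.
    by rewrite -e' td eqxx addn1.
  rewrite inE => /andP[cB /eqP Bd].
  have [|s [ts ps ss]] := sandwiched_cut tp cB; first by rewrite /dvdn Bd modnn.
  exists s; split=> //; apply/ffunP => t; apply/eqP; rewrite -(eqn_add2r (t.+1 == d)).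
  rewrite e' -ss (ebasis_mod Bd) ebasis_basis ?d0 ?leqnn //.
  by rewrite [in X in _ == X]ffunE [in X in _ == _ + X]ffunE.
(* If [i] or [j] is [d], then [k] is the other one and the covering only removes [basis d d]. *)
case: (eqVneq j d) => [jd|jd].
  apply: cut => t; have := e t; suff -> : k = i by lia.
  by apply/eqP; rewrite -(eq_label_mod hk hi) (eqP kij) jd modnDr.
case: (eqVneq i d) => [id|id].
  apply: cut => t; have := e t; suff -> : k = j by lia.
  by apply/eqP; rewrite -(eq_label_mod hk hj) (eqP kij) id modnDl.
(* Now [k] cannot restore a coordinate lowered by [i] or [j], so the signature of [p] has blocks of
   both residues to merge. *)
have ki : k != i.
  apply: contraNneq jd => ki; rewrite -(eq_label_mod hj) ?leqnn; last lia.
  by rewrite modnn -(mod0n d) -(eqn_modDl i) addn0 -(eqP kij) ki.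
have kj : k != j.
  apply: contraNneq id => kj; rewrite -(eq_label_mod hi) ?leqnn; last lia.
  by rewrite modnn -(mod0n d) -(eqn_modDr j) add0n -(eqP kij) kj.
have [t ti|B1] := @residue_class_neq0 d n p i hi; first by have := e t; lia.
move=> B1i.
have [B2 B2j B12] : exists2 B2, B2 \in residue_class d (pblock p) j & B1 != B2.
  (* When [i = j] that coordinate is at least 2, so a second block remains after removing [B1]. *)
  case: (eqVneq i j) => [ij|ij].
    have id' : i.-1 < d by lia.
    have ti : (Ordinal id').+1 = i by rewrite /=; lia.
    have := signature_card (Ordinal id') (@labels_pblock _ p).
    rewrite ti (cardsD1 B1) B1i => c; have : 0 < #|residue_class d (pblock p) i :\ B1|.
      by move: (e (Ordinal id')) c; rewrite ti -ij eqxx eq_sym (negPf ki); clear; lia.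
    case/card_gt0P=> B2; rewrite in_setD1 => /andP[B21 B2i].
    by exists B2; rewrite -?ij // eq_sym.
  have [t tj|B2 B2j] := @residue_class_neq0 d n p j hj; first by have := e t; lia.
  exists B2 => //; apply: contraNneq ij => B12.
  rewrite -(eq_label_mod hi hj); move: B1i B2j; rewrite !inE B12.
  by case/andP=> _ /eqP <- /andP[_ /eqP ->].
move: B1i B2j; rewrite !inE => /andP[c1 /eqP r1] /andP[c2 /eqP r2].
have [s [ts ps ss]] := sandwiched_merge tp c1 c2 B12.
exists s; split=> //; apply/ffunP => t.
have kE : nup (pblock p) B1 + nup (pblock p) B2 = k %[mod d].
  by rewrite (eqP kij) -modnDm r1 r2 modnDm.
move: ss; rewrite (ebasis_mod r1) (ebasis_mod r2) (ebasis_mod kE) !ebasis_basis //.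
have addE (u w : Lambda d) : (u + w)%R t = u t + w t by rewrite ffunE.
have basisE m : basis d m t = (t.+1 == m) by rewrite ffunE.
by move/ffunP/(_ t); rewrite !addE !basisE -e => /addIn.
Qed.

(** * Principal ideals and the isomorphism *)

Lemma ideal2P d n (s p : tonal_part d n) :
  s \in ideal2 p <-> sandwiched d (val p) (val s).
Proof.
split=> [/imset2P[x y _ _ ->]|[x [y [tx ty e]]]].
  by exists (val x), (val y); split; [exact: valP|exact: valP|].
apply/imset2P; exists (exist _ x tx) (exist _ y ty) => //; exact: val_inj.
Qed.

Lemma ideal2_trans d n (q s p : tonal_part d n) :
  s \in ideal2 q -> q \in ideal2 p -> s \in ideal2 p.
Proof.
move=> /imset2P[x y _ _ ->] /imset2P[x' y' _ _ ->].
by apply/imset2P; exists (x * x')%g (y' * y)%g; rewrite // !mulgA.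
Qed.

Lemma ideal2_sub d n (s p : tonal_part d n) :
  (ideal2 s \subset ideal2 p) = (s \in ideal2 p).
Proof.
apply/subsetP/idP => [|sp q qs]; last exact: ideal2_trans qs sp.
by apply; apply/imset2P; exists 1%g 1%g; rewrite // mul1g mulg1.
Qed.

(** Induction on the chain of coverings, for all [p], since each intermediate element takes over the
    role of [p]. *)
Lemma prec_realized d n (v : Lambda d) (p : tonal_part d n) :
  prec v (signature d (val p)) ->
  exists2 s, s \in ideal2 p & signature d (val s) = v.
Proof.
move/asboolP; move: {-1}(signature d (val p)) (erefl (signature d (val p))) => w.
move=> + vw; elim: vw p => {v w} [v w vw|v u w _ IHv _ IHw] p pw.
  rewrite -pw in vw; have [s [ts ps sv]] := sandwiched_covered (valP p) vw.
  by exists (exist _ s ts) => //; apply/ideal2P.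
have [q qp qu] := IHw p pw; have [s sq sv] := IHv q qu.
by exists s => //; exact: ideal2_trans sq qp.
Qed.

(** Products lower signatures. Conversely, descend from [p] to some [q] with the signature of [s],
    and pass from [q] to [s] by matching blocks. *)
Lemma ideal2_signature d n (s p : tonal_part d n) : 0 < d ->
  (s \in ideal2 p) = (signature d (val s) <= signature d (val p))%O.
Proof.
move=> d0; apply/idP/idP => [/ideal2P[x [y [tx ty ->]]]|].
  have [_ mulM] := tonal_monoid_closed d n; have txp := mulM _ _ tx (valP p).
  exact: le_trans (signature_mul_le d0 txp ty).2 (signature_mul_le d0 tx (valP p)).1.
have eq_case q : signature d (val s) = signature d (val q) -> s \in ideal2 q.
  move=> /(eq_signature_reduction d0 (valP s) (valP q))[f red].
  apply/ideal2P; apply: (reduction_sandwich (valP s) (valP q) _ _ red).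
    exact: labels_pblock.
  exact: labels_pblock.
rewrite Lambda_leE => /orP[/eqP/eq_case//|/prec_realized[q qp qs]].
by apply: ideal2_trans qp; apply: eq_case.
Qed.

Lemma signature_id d n : 0 < d -> signature d (id_part n) = (basis d 1 *+ n)%R.
Proof.
move=> d0; have idL : labels (id_part n) (@underlying n) := @same_block_id n.
have up i : nup (@underlying n) i = 1.
  by rewrite -(cards1 i); apply: eq_card => j; rewrite !inE.
have low i : nlow (@underlying n) i = 1.
  by rewrite -(cards1 i); apply: eq_card => j; rewrite !inE.
rewrite (signature_labels d idL) (eq_bigl xpredT) => [|i]; last first.
  by rewrite /crosses up low.
under eq_bigr do rewrite up ebasis_basis ?d0 //.
by rewrite sumr_const card_ord.
Qed.

Theorem theorem6p5 (d n : nat) (d_gt0 : (0 < d)%N) :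
  (forall s p : tonal_part d n,
     Jeq s p -> signature d (val s) = signature d (val p)) /\
  exists Psi : Jclass d n -> down_set (basis d 1 *+ n)%R,
    [/\ forall s : tonal_part d n,
          val (Psi (\pi_(Jclass d n) s)%qT) = signature d (val s),
        bijective Psi
      & {mono Psi : x y / (x <= y)%O}].
Proof.
have sigJ (s p : tonal_part d n) : Jeq s p -> signature d (val s) = signature d (val p).
  rewrite /Jeq eqEsubset !ideal2_sub !(ideal2_signature _ _ d_gt0) => h.
  exact: le_anti h.
split=> //.
have sig1 : signature d (val (1%g : tonal_part d n)) = (basis d 1 *+ n)%R.
  exact: signature_id.
(* Every element lies in the ideal of the identity, whose signature is the top vector. *)
have down_sig (s : tonal_part d n) : signature d (val s) \in down d (basis d 1 *+ n)%R.
  rewrite inE -Lambda_leE -sig1 -(ideal2_signature _ _ d_gt0).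
  by apply/imset2P; exists s 1%g; rewrite // !mulg1.
pose Psi (J : Jclass d n) : down_set (basis d 1 *+ n)%R :=
  exist (fun w => w \in down d (basis d 1 *+ n)%R) _ (down_sig (repr J)).
have PsiE s : val (Psi (\pi_(Jclass d n) s)%qT) = signature d (val s).
  by apply: sigJ; rewrite /Jeq ideal2_repr.
have Psi_mono : {mono Psi : x y / (x <= y)%O}.
  elim/quotW => s; elim/quotW => p.
  rewrite -[LHS]/(val (Psi _) <= val (Psi _))%O !PsiE -ideal2_signature //.
  by rewrite -ideal2_sub -JleE.
exists Psi; split=> //.
(* Surjectivity comes from realising chains that start at the identity. *)
have sig_onto w : w \in down d (basis d 1 *+ n)%R ->
    exists s : tonal_part d n, signature d (val s) = w.
  rewrite inE -sig1 => /orP[/eqP ->|/prec_realized[s _ <-]]; last by exists s.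
  by exists 1%g.
have surj v : exists J, Psi J == v.
  have [s sv] := sig_onto _ (valP v).
  by exists (\pi_(Jclass d n) s)%qT; rewrite -val_eqE PsiE sv.
(* The inverse picks some preimage; it is unique because [Psi] reflects the order. *)
exists (fun v => xchoose (surj v)) => [J|v]; last exact/eqP/(xchooseP (surj v)).
have /eqP e := xchooseP (surj (Psi J)).
by apply: le_anti; rewrite -!Psi_mono e lexx.
Qed.
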